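(* For any convex body $K\subset\mathbb{R}^n$ containing the origin and every $\lambda\in[0,1]$, \[ \mathrm{Vol}\big((1-\lambda)K\vee(-\lambda K)\big)\le \mathrm{Vol}(K). \]
   Context: A convex body is a compact convex subset of $\mathbb{R}^n$ with non-empty interior. For sets $A,B$, $A\vee B$ denotes the convex hull of $A\cup B$. *)

(* Defs.v *)
From HB Require Import structures.
From mathcomp Require Import all_boot all_order all_algebra.
From mathcomp Require Import all_classical all_reals all_analysis.
Set Implicit Arguments. Unset Strict Implicit. Unset Printing Implicit Defensive.
Import Order.TTheory GRing.Theory Num.Theory.
Import numFieldNormedType.Exports.
Local Open Scope classical_set_scope.
Local Open Scope ring_scope.

Definition convex_set (R : realType) (n : nat) (K : set 'rV[R]_n) : Prop :=
  forall x y t, K x -> K y -> 0 <= t <= 1 -> K ((1 - t) *: x + t *: y).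

Definition convex_body (R : realType) (n : nat) (K : set 'rV[R]_n) : Prop :=
  [/\ compact K, convex_set K & (interior K) !=set0].

Definition conv_hull (R : realType) (n : nat) (A : set 'rV[R]_n) : set 'rV[R]_n :=
  [set x | exists (m : nat) (p : 'I_m -> 'rV[R]_n) (w : 'I_m -> R),
     [/\ forall i, A (p i), forall i, 0 <= w i, \sum_(i < m) w i = 1
       & x = \sum_(i < m) w i *: p i]].

Definition cvx_join (R : realType) (n : nat) (A B : set 'rV[R]_n) : set 'rV[R]_n :=
  conv_hull (A `|` B).

Definition dilate (R : realType) (n : nat) (c : R) (K : set 'rV[R]_n) : set 'rV[R]_n :=
  [set c *: x | x in K].

Definition in_box (R : realType) (n : nat) (a b : 'rV[R]_n) (x : 'rV[R]_n) : Prop :=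
  forall i, a 0 i <= x 0 i <= b 0 i.

Definition box_vol (R : realType) (n : nat) (a b : 'rV[R]_n) : R :=
  \prod_(i < n) (b 0 i - a 0 i).

Definition piece_set (R : realType) (n : nat) (o : option ('rV[R]_n * 'rV[R]_n))
  : set 'rV[R]_n :=
  if o is Some ab then [set x | in_box ab.1 ab.2 x] else set0.

Definition piece_vol (R : realType) (n : nat) (o : option ('rV[R]_n * 'rV[R]_n))
  : \bar R :=
  if o is Some ab then (box_vol ab.1 ab.2)%:E else 0%E.

Definition valid_piece (R : realType) (n : nat) (o : option ('rV[R]_n * 'rV[R]_n))
  : Prop :=
  if o is Some ab then forall i, ab.1 0 i <= ab.2 0 i else True.

(* n-dimensional Lebesgue (outer) measure: infimum of the total volumes of
   countable covers by closed boxes. On Lebesgue-measurable sets (e.g. compact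
   sets) this is the Lebesgue measure Vol. *)
Definition Vol (R : realType) (n : nat) (A : set 'rV[R]_n) : \bar R :=
  ereal_inf [set s | exists c : nat -> option ('rV[R]_n * 'rV[R]_n),
    [/\ forall k, valid_piece (c k),
        A `<=` \bigcup_k piece_set (c k)
      & s = (\sum_(0 <= k <oo) piece_vol (c k))%E]].

(* Main.v *)
(* Assume first that the origin is interior to K and 0 < l < 1, and write
   A = (1-l)K, B = lK, D = l(1-l)K, M = A v (-B). If z = a - b with
   a in (i(1-t))A and b in (it)B, and u is in jD, then x = z + (b + u) and
   y = b + u lie in rA and (i+j-r)B for r = i(1-t) + jl. The map
   (z, u) -> (x, y) preserves volume, so the union of the sets iM x jD over
   i + j = m has volume at most that of the union of the sets iA x jB; this is
   the Rogers-Shephard argument, which gives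
   Vol(M) Vol(D) <= Vol(A) Vol(B), that is Vol(M) <= Vol(K).
   Volumes are compared here by counting the integer points of large dilates: b is
   rounded to an integer vector, which costs one level, and such level shifts
   are harmless because the resulting sums grow only polynomially in m.
   A convex body containing the origin is replaced by K + [-d, d]^n, which for
   small d has, asymptotically, at most (Vol(K) + eps) s^n integer points in its
   s-th dilate, by compactness. *)

Require Import Defs.
From HB Require Import structures.
From mathcomp Require Import all_boot all_order all_algebra.
From mathcomp Require Import all_classical all_reals all_analysis.
From mathcomp Require Import zify ring lra.
Import Order.TTheory GRing.Theory Num.Theory.
Import numFieldNormedType.Exports.
Import Defs.
Local Open Scope classical_set_scope.
Local Open Scope ring_scope.
Set Implicit Arguments. Unset Strict Implicit. Unset Printing Implicit Defensive.

(** * Dilates of convex sets, and the join of [(1 - lambda)K] and [- lambda K] *)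

Definition cube (R : realType) (n : nat) (r : R) : set 'rV[R]_n :=
  [set x | forall i, `|x 0 i| <= r].

Lemma dilate_dilate (R : realType) (n : nat) (a b : R) (K : set 'rV[R]_n) x :
  dilate b K x -> dilate (a * b) K (a *: x).
Proof. by case=> y Ky <-; exists y => //; rewrite scalerA. Qed.

Lemma dilateS (R : realType) (n : nat) (a : R) (K L : set 'rV[R]_n) :
  K `<=` L -> dilate a K `<=` dilate a L.
Proof. by move=> KL _ [x Kx <-]; exists x => //; exact: KL. Qed.

Lemma dilate_convex (R : realType) (n : nat) (a : R) (K : set 'rV[R]_n) :
  convex_set K -> convex_set (dilate a K).
Proof.
move=> cK _ _ t [x Kx <-] [y Ky <-] t01; exists ((1 - t) *: x + t *: y).
  exact: cK.
by rewrite scalerDr !scalerA ![a * _]mulrC.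
Qed.

(** For [a + b > 0] the sum is [a + b] times the convex combination with second weight
    [b / (a + b)]. *)
Lemma dilateD (R : realType) (n : nat) (a b : R) (K : set 'rV[R]_n) x y :
  convex_set K -> 0 <= a -> 0 <= b -> dilate a K x -> dilate b K y ->
  dilate (a + b) K (x + y).
Proof.
move=> cK a0 b0 [u Ku <-] [v Kv <-].
have [ab0|ab_neq0] := eqVneq (a + b) 0.
  have /andP[/eqP -> /eqP ->] : (a == 0) && (b == 0) by rewrite -paddr_eq0 // ab0.
  by exists u => //; rewrite addr0 !scale0r addr0.
have ab_gt0 : 0 < a + b by rewrite lt_neqAle eq_sym ab_neq0 addr_ge0.
exists ((1 - b / (a + b)) *: u + (b / (a + b)) *: v).
  apply: cK => //; apply/andP; split; first by rewrite divr_ge0 // ltW.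
  by rewrite ler_pdivrMr // mul1r lerDr.
rewrite scalerDr !scalerA mulrBr mulr1 mulrCA mulfV // mulr1.
by rewrite addrK.
Qed.

Lemma dilate_le (R : realType) (n : nat) (a b : R) (K : set 'rV[R]_n) :
  convex_set K -> K 0 -> 0 <= a <= b -> dilate a K `<=` dilate b K.
Proof.
move=> cK K0 /andP[a0 ab] x ax.
rewrite -[x]addr0 -(subrKC a b); apply: dilateD => //; first by rewrite subr_ge0.
by exists 0 => //; rewrite scaler0.
Qed.

Lemma dilate_sum (R : realType) (n m : nat) (K : set 'rV[R]_n)
    (P : pred 'I_m) (p : 'I_m -> 'rV[R]_n) (w : 'I_m -> R) :
  convex_set K -> K 0 -> (forall i, 0 <= w i) -> (forall i, P i -> K (p i)) ->
  dilate (\sum_(i | P i) w i) K (\sum_(i | P i) w i *: p i).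
Proof.
move=> cK K0 w0 Kp.
(* The sign of the partial weight is carried along, because [dilateD] asks for it. *)
suff [] : dilate (\sum_(i | P i) w i) K (\sum_(i | P i) w i *: p i) /\
  0 <= \sum_(i | P i) w i by [].
apply: (big_ind2 (fun x a => dilate a K x /\ 0 <= a)).
- by split => //; exists 0 => //; rewrite scaler0.
- by move=> x a y b [ax a0] [bx b0]; split; [exact: dilateD | exact: addr_ge0].
- by move=> i Pi; split => //; exists (p i) => //; exact: Kp.
Qed.

(* For convex K containing 0 this is the convex hull of (1 - lambda)K and -lambda K,
   written without convex combinations of arbitrary length. *)
Definition signed_join (R : realType) (n : nat) (lambda : R) (K : set 'rV[R]_n) :
    set 'rV[R]_n :=
  [set x | exists t a b, [/\ 0 <= t <= 1, dilate ((1 - t) * (1 - lambda)) K a,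
     dilate (t * lambda) K b & x = a - b]].

(** The points of a convex combination are grouped by the set they belong to, and [t] is the total
    weight of those outside [(1 - lambda)K]. By monotonicity of [Vol], it then suffices to bound
    [signed_join]. *)
Lemma cvx_join_sub_signed_join (R : realType) (n : nat) (lambda : R) (K : set 'rV[R]_n) :
  convex_set K -> K 0 ->
  cvx_join (dilate (1 - lambda) K) (dilate (- lambda) K) `<=` signed_join lambda K.
Proof.
move=> cK K0 _ [m [p [w [Kp w0 w1 ->]]]].
pose P i := `[< dilate (1 - lambda) K (p i) >].
have K'0 c : dilate c K 0 by exists 0 => //; rewrite scaler0.
have w1' : 1 - \sum_(i | ~~ P i) w i = \sum_(i | P i) w i.
  by rewrite -w1 (bigID P) /= addrK.
exists (\sum_(i | ~~ P i) w i), (\sum_(i | P i) w i *: p i),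
  (\sum_(i | ~~ P i) w i *: - p i); split.
- apply/andP; split; first exact: sumr_ge0.
  by rewrite -subr_ge0 w1' sumr_ge0.
- rewrite w1'.
  have [y Ky <-] := @dilate_sum _ _ _ _ P p w (dilate_convex cK) (K'0 (1 - lambda)) w0
    (fun i Pi => asboolW Pi).
  exact: dilate_dilate.
- have [] := @dilate_sum _ _ _ (dilate lambda K) (fun i => ~~ P i) (fun i => - p i) w
    (dilate_convex cK) (K'0 lambda) w0.
    move=> i /asboolPn Pi; case: (Kp i) => // -[y Ky <-]; exists y => //.
    by rewrite scaleNr opprK.
  by move=> y Ky <-; exact: dilate_dilate.
- rewrite (bigID P) /= -sumrN; congr (_ + _); apply: eq_bigr => i _.
  by rewrite scalerN opprK.
Qed.

Lemma signed_joinS (R : realType) (n : nat) (lambda : R) (K L : set 'rV[R]_n) :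
  K `<=` L -> signed_join lambda K `<=` signed_join lambda L.
Proof.
move=> KL x [t [a [b [t01 Ka Kb ->]]]]; exists t, a, b.
by split => //; exact: (dilateS KL).
Qed.

(** Both dilation factors are affine in [t], so mixing two representations mixes their
    parameters. *)
Lemma signed_join_convex (R : realType) (n : nat) (lambda : R) (K : set 'rV[R]_n) :
  0 <= lambda <= 1 -> convex_set K -> convex_set (signed_join lambda K).
Proof.
move=> /andP[l0 l1] cK _ _ u [t [a [b [/andP[t0 t1] Ka Kb ->]]]]
  [t' [a' [b' [/andP[t0' t1'] Ka' Kb' ->]]]] /andP[u0 u1].
have ul : 0 <= 1 - u by rewrite subr_ge0.
have ll : 0 <= 1 - lambda by rewrite subr_ge0.
have tl : 0 <= 1 - t by rewrite subr_ge0.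
have tl' : 0 <= 1 - t' by rewrite subr_ge0.
exists ((1 - u) * t + u * t'), ((1 - u) *: a + u *: a'), ((1 - u) *: b + u *: b').
split.
- apply/andP; split; first by rewrite addr_ge0 // mulr_ge0.
  rewrite -subr_ge0.
  have -> : 1 - ((1 - u) * t + u * t') = (1 - u) * (1 - t) + u * (1 - t') by ring.
  by rewrite addr_ge0 // mulr_ge0.
- have -> : (1 - ((1 - u) * t + u * t')) * (1 - lambda) =
    (1 - u) * ((1 - t) * (1 - lambda)) + u * ((1 - t') * (1 - lambda)) by ring.
  by apply: dilateD; rewrite ?mulr_ge0 //; exact: dilate_dilate.
- have -> : ((1 - u) * t + u * t') * lambda = (1 - u) * (t * lambda) + u * (t' * lambda).
    by ring.
  by apply: dilateD; rewrite ?mulr_ge0 //; exact: dilate_dilate.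
- by rewrite !scalerBr opprD addrACA.
Qed.

Lemma dilate_sub_signed_join (R : realType) (n : nat) (lambda : R) (K : set 'rV[R]_n) :
  K 0 -> dilate (1 - lambda) K `<=` signed_join lambda K.
Proof.
move=> K0 x Kx; exists 0, x, 0; rewrite subr0 mul1r mul0r; split => //.
- by rewrite lexx ler01.
- by exists 0 => //; rewrite scaler0.
- by rewrite subr0.
Qed.

Lemma signed_join_cube (R : realType) (n : nat) (lambda r : R) (K : set 'rV[R]_n) :
  0 <= lambda <= 1 -> 0 <= r ->
  K `<=` @cube R n r -> signed_join lambda K `<=` @cube R n r.
Proof.
move=> /andP[l0 l1] r0 Kr _ [t [_ [_ [/andP[t0 t1] [a Ka <-] [b Kb <-] ->]]]] i.
rewrite !mxE (le_trans (ler_normB _ _)) // !normrM.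
have ll : 0 <= 1 - lambda by rewrite subr_ge0.
have tl : 0 <= 1 - t by rewrite subr_ge0.
rewrite (ger0_norm ll) (ger0_norm tl) (ger0_norm t0) (ger0_norm l0).
have := Kr _ Ka i; have := Kr _ Kb i => rb ra.
have -> : r = (1 - t) * r + t * r by ring.
apply: lerD; rewrite -mulrA ler_wpM2l //.
  by apply: (le_trans _ ra); rewrite ler_piMl // lerBlDr lerDl.
by apply: (le_trans _ rb); rewrite ler_piMl.
Qed.

(** * Counting levels of two increasing predicates *)

Lemma sum_nat_geq (p M : nat) : (\sum_(i < M.+1) (p <= i) = M.+1 - p)%N.
Proof.
elim: M => [|M IH]; first by rewrite big_ord1 /=; case: p.
by rewrite big_ord_recr /= IH; case: (leqP p M.+1) => /= ?; lia.
Qed.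

(** The indices counted form the interval [[p, M - q]]; truncated subtraction gives 0 when it is
    empty. *)
Lemma conv_count_thresholds (p q M : nat) :
  (\sum_(i < M.+1) ((p <= i) && (q <= M - i)) = M.+1 - (p + q))%N.
Proof.
elim: p M => [|p IH] M.
  rewrite -(sum_nat_geq q) (reindex_inj rev_ord_inj) /=.
  by apply: eq_bigr => i _; rewrite /= subSS subKn // -ltnS.
case: M => [|M]; first by rewrite big_ord1 /=; lia.
rewrite big_ord_recl /= add0n -[RHS]/(M.+1 - (p + q))%N -IH.
by apply: eq_bigr => i _; rewrite /bump /= add1n subSS.
Qed.

Lemma mono_pred_threshold (P : pred nat) :
  (forall i, P i -> P i.+1) ->
  (forall i, P i = false) \/ exists p, forall i, P i = (p <= i)%N.
Proof.
move=> mP.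
have [ex|nex] := pselect (exists i, P i); last first.
  by left=> i; apply/negP => Pi; apply: nex; exists i.
right; case: (ex_minnP ex) => p Pp pmin; exists p => i.
apply/idP/idP; first exact: pmin.
elim: i => [|i IH]; first by rewrite leqn0 => /eqP <-.
by rewrite leq_eqVlt => /predU1P[<- //|/IH /mP].
Qed.

(** An increasing predicate is identically false or a threshold. For thresholds [p] and [q], a
    splitting of [m] exists exactly when [p + q <= m], so the right-hand side also counts
    [M + 1 - p - q] levels. *)
Lemma conv_count (P Q : pred nat) (M : nat) :
  (forall i, P i -> P i.+1) -> (forall i, Q i -> Q i.+1) ->
  (\sum_(i < M.+1) (P i && Q (M - i)%N) =
   \sum_(m < M.+1) [exists i : 'I_m.+1, P i && Q (m - i)%N])%N.
Proof.
move=> /mono_pred_threshold[P0|[p Pp]] /mono_pred_threshold[Q0|[q Qq]].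
1,2,3: rewrite !big1 // => i _; [apply/eqP; rewrite eqb0; apply/existsPn => j | ];
  by rewrite ?P0 ?Q0 ?andbF.
under eq_bigr do rewrite Pp Qq.
rewrite conv_count_thresholds -sum_nat_geq; apply: eq_bigr => m _.
congr nat_of_bool; apply/idP/existsP => [le_m|[i]]; last first.
  by rewrite Pp Qq; have := ltn_ord i; lia.
have pm : (p < m.+1)%N by lia.
by exists (Ordinal pm); rewrite Pp Qq /=; lia.
Qed.

(** * Integer points and the discrete Rogers-Shephard inequality *)

Definition gpt (R : realType) (n N : nat) (t : {ffun 'I_n -> 'I_N.*2.+1}) : 'rV[R]_n :=
  \row_i ((t i)%:R - N%:R).

(* The number of points of Y with integer coordinates in [-N, N]; gpt shifts the
   index set {0, ..., 2N} to {-N, ..., N}. *)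
Definition lat (R : realType) (n N : nat) (Y : set 'rV[R]_n) : nat :=
  #|[set t : {ffun 'I_n -> 'I_N.*2.+1} | `[< Y (gpt R t) >]]%SET|.

Lemma gpt_inj (R : realType) (n N : nat) : injective (@gpt R n N).
Proof.
move=> t u /rowP tu; apply/ffunP => i; have := tu i; rewrite !mxE => /addIr/eqP.
by rewrite eqr_nat => /eqP/val_inj.
Qed.

Lemma gpt_int (R : realType) (n N : nat) (t : {ffun 'I_n -> 'I_N.*2.+1}) i :
  gpt R t 0 i \is a Num.int.
Proof. by rewrite mxE rpredB // natr_int. Qed.

Lemma gpt_onto (R : realType) (n N : nat) (x : 'rV[R]_n) :
  (forall i, x 0 i \is a Num.int) -> @cube R n N%:R x ->
  exists t : {ffun 'I_n -> 'I_N.*2.+1}, gpt R t = x.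
Proof.
(* The shift by [N] makes the coordinates naturals at most [2N], so [absz] and [inord] lose
   nothing. *)
move=> xint xN; exists [ffun i => inord (absz (Num.floor (x 0 i + N%:R)))].
apply/rowP => i; rewrite !mxE ffunE.
have /andP[xl xr] : - N%:R <= x 0 i <= N%:R by rewrite -ler_norml; exact: xN.
have x0 : 0 <= x 0 i + N%:R by lra.
have f0 : (0 <= Num.floor (x 0 i + N%:R))%R by rewrite floor_ge0.
have fE : ((absz (Num.floor (x 0 i + N%:R)))%:R : R) = x 0 i + N%:R.
  by rewrite natr_absz ger0_norm // floorK // rpredD // natr_int.
rewrite inordK; first by rewrite fE addrK.
by rewrite ltnS -(ler_nat R) fE -addnn natrD lerD2r.
Qed.

Lemma latS (R : realType) (n N : nat) (Y Z : set 'rV[R]_n) :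
  Y `<=` Z -> (lat N Y <= lat N Z)%N.
Proof.
move=> YZ; apply: subset_leq_card; apply/fintype.subsetP => t; rewrite !inE.
exact: YZ.
Qed.

Definition conv_pairs (R : realType) (n N : nat) (E F : nat -> set 'rV[R]_n) (m : nat) :=
  [set z : {ffun 'I_n -> 'I_N.*2.+1} * {ffun 'I_n -> 'I_N.*2.+1} |
    [exists i : 'I_m.+1, `[< E i (gpt R z.1) >] && `[< F (m - i)%N (gpt R z.2) >]]]%SET.

(* For nested families each pair of points contributes (M + 1 - p - q)_+ to both
   sides, where p and q are the first levels at which its points appear. *)
Lemma sum_card_conv_pairs (R : realType) (n N : nat) (E F : nat -> set 'rV[R]_n) (M : nat) :
  (forall i, E i `<=` E i.+1) -> (forall i, F i `<=` F i.+1) ->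
  (\sum_(i < M.+1) lat N (E i) * lat N (F (M - i)) =
   \sum_(m < M.+1) #|@conv_pairs R n N E F m|)%N.
Proof.
move=> mE mF.
have cardE i j : (lat N (E i) * lat N (F j) =
    \sum_(z : {ffun 'I_n -> 'I_N.*2.+1} * {ffun 'I_n -> 'I_N.*2.+1})
       (`[< E i (gpt R z.1) >] && `[< F j (gpt R z.2) >]))%N.
  rewrite /lat -cardsX -sum1_card big_mkcond /=; apply: eq_bigr => -[u v] _.
  by rewrite finset.in_setX !finset.in_set; case: ifP.
under eq_bigr do rewrite cardE.
rewrite exchange_big /=.
under [RHS]eq_bigr do rewrite -sum1_card big_mkcond /=.
rewrite [RHS]exchange_big /=; apply: eq_bigr => z _.
rewrite (@conv_count (fun i => `[< E i (gpt R z.1) >]) (fun i => `[< F i (gpt R z.2) >])).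
- by apply: eq_bigr => m _; rewrite finset.in_set; case: ifP.
- by move=> i /asboolP/mE/asboolP.
- by move=> i /asboolP/mF/asboolP.
Qed.

(* q depends on z only, which makes (z, u) -> (z + u + q, u + q) injective; it is
   taken at the first level of z, where the constraint on u is the weakest. *)
Lemma card_conv_pairs_le (R : realType) (n N m k : nat) (A B C D : nat -> set 'rV[R]_n) :
  (forall i j, (i <= j)%N -> D i `<=` D j) ->
  (forall j, (j <= m + k)%N -> A j `<=` @cube R n N%:R) ->
  (forall j, (j <= m + k)%N -> B j `<=` @cube R n N%:R) ->
  (forall i z, C i z -> exists q : 'rV[R]_n, (forall c, q 0 c \is a Num.int) /\
    forall m u, (i <= m)%N -> D (m - i)%N u ->
      exists2 j, (j <= m + k)%N & A j (z + (u + q)) /\ B (m + k - j)%N (u + q)) ->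
  (#|@conv_pairs R n N C D m| <= #|@conv_pairs R n N A B (m + k)|)%N.
Proof.
move=> mD AN BN shift.
have /choice[q qP] : forall z, exists q : 'rV[R]_n, (forall c, q 0 c \is a Num.int) /\
    forall i u, (i <= m)%N -> C i z -> D (m - i)%N u ->
      exists2 j, (j <= m + k)%N & A j (z + (u + q)) /\ B (m + k - j)%N (u + q).
  move=> z; have [ex|nex] := pselect (exists i, `[< C i z >]); last first.
    (* Junk value for a point that lies in no [C i]. *)
    exists 0; split=> [c|i u _ Ci]; first by rewrite mxE rpred0.
    by exfalso; apply: nex; exists i; apply/asboolP.
  case: (ex_minnP ex) => i0 /asboolP Ci0 imin.
  have [q [qint qP]] := shift i0 z Ci0; exists q; split => // i u im /asboolP Ci Du.
  have i0i := imin _ Ci.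
  apply: qP; first exact: leq_trans im.
  by apply: mD Du; rewrite leq_sub2l.
have /choice[f fP] : forall w, exists w', w \in @conv_pairs R n N C D m ->
    [/\ w' \in @conv_pairs R n N A B (m + k),
        gpt R w'.1 = gpt R w.1 + (gpt R w.2 + q (gpt R w.1))
      & gpt R w'.2 = gpt R w.2 + q (gpt R w.1)].
  move=> [z u]; have [|nS] := boolP ((z, u) \in @conv_pairs R n N C D m); last by exists (z, u).
  rewrite finset.in_set => /existsP[i /andP[/asboolP Ci /asboolP Du]].
  have [qint qshift] := qP (gpt R z).
  have im : (i <= m)%N by rewrite -ltnS.
  have [j jmk [Aj Bj]] := qshift i (gpt R u) im Ci Du.
  have int2 c : (gpt R u + q (gpt R z)) 0 c \is a Num.int.
    by rewrite mxE rpredD // gpt_int.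
  have [t1 t1E] := @gpt_onto R n N (gpt R z + (gpt R u + q (gpt R z)))
    (fun c => ltac:(by rewrite mxE rpredD // gpt_int)) (AN j jmk _ Aj).
  have [t2 t2E] := @gpt_onto R n N _ int2 (BN _ (leq_subr _ _) _ Bj).
  exists (t1, t2) => _; split => //.
  rewrite finset.in_set; apply/existsP.
  have jlt : (j < (m + k).+1)%N by rewrite ltnS.
  exists (Ordinal jlt) => /=.
  by rewrite t1E t2E; apply/andP; split; apply/asboolP.
(* The difference of the two image points is [gpt R z]; it fixes [q], and then the second point
   gives [u]. *)
rewrite -(@card_in_imset _ _ f (@conv_pairs R n N C D m)); last first.
  move=> [z u] [z' u'] /fP[_ e1 e2] /fP[_ e1' e2'] ff'.
  rewrite /= ff' in e1 e2 e1' e2'.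
  rewrite e2' in e2.
  have zz' : z' = z.
    by apply: (@gpt_inj R); move: e1; rewrite e1' e2 => /addIr.
  rewrite zz' in e2 *; congr (_, _).
  by apply: (@gpt_inj R); move/addIr: e2.
apply: subset_leq_card; apply/fintype.subsetP => _ /imsetP[w wS ->].
by have [] := fP w wS.
Qed.

(** Level [m] on the left injects into level [m + k] on the right; the first [k] levels on the right
    are dropped. *)
Lemma sum_lat_conv_le (R : realType) (n N M k : nat) (A B C D : nat -> set 'rV[R]_n) :
  (forall i j, (i <= j)%N -> A i `<=` A j) ->
  (forall i j, (i <= j)%N -> B i `<=` B j) ->
  (forall i j, (i <= j)%N -> C i `<=` C j) ->
  (forall i j, (i <= j)%N -> D i `<=` D j) ->
  (forall j, (j <= M + k)%N -> A j `<=` @cube R n N%:R) ->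
  (forall j, (j <= M + k)%N -> B j `<=` @cube R n N%:R) ->
  (forall i z, C i z -> exists q : 'rV[R]_n, (forall c, q 0 c \is a Num.int) /\
    forall m u, (i <= m)%N -> D (m - i)%N u ->
      exists2 j, (j <= m + k)%N & A j (z + (u + q)) /\ B (m + k - j)%N (u + q)) ->
  (\sum_(i < M.+1) lat N (C i) * lat N (D (M - i)) <=
   \sum_(i < (M + k).+1) lat N (A i) * lat N (B (M + k - i)))%N.
Proof.
move=> mA mB mC mD AN BN shift.
rewrite !sum_card_conv_pairs; [ | by move=> i; auto ..].
rewrite -addSn addnC big_split_ord /=; apply: leq_trans (leq_addl _ _).
apply: leq_sum => m _; rewrite (addnC k m).
have mM : (m <= M)%N by rewrite -ltnS.
by apply: card_conv_pairs_le => // j jm; [apply: AN|apply: BN]; lia.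
Qed.

(** * Rounding to integer vectors, and the level shift for the join *)

Lemma int_translate (R : realType) (n : nat) (x : 'rV[R]_n) :
  exists q : 'rV[R]_n, (forall c, q 0 c \is a Num.int) /\
    forall c, q 0 c <= x 0 c <= q 0 c + 1.
Proof.
exists (\row_c (Num.floor (x 0 c))%:~R); split=> c; rewrite mxE; first exact: intr_int.
by rewrite floor_le /= -[1]/(1%:~R) -intrD ltW // floorD1_gt.
Qed.

(** A point of the [r]-cube is [r / d] times a point of the [d]-cube, and [r / d <= c]. The case
    [r = 0] is separate because the rescaling is by [d / r]. *)
Lemma cube_sub_dilate (R : realType) (n : nat) (r d c : R) (X : set 'rV[R]_n) :
  0 < d -> convex_set X -> @cube R n d `<=` X -> 0 <= r <= c * d ->
  @cube R n r `<=` dilate c X.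
Proof.
move=> d0 cX dX /andP[r0 rcd] x xr.
have X0 : X 0 by apply: dX => i; rewrite mxE normr0 ltW.
apply: (@dilate_le _ _ (r / d)) => //.
  by rewrite divr_ge0 ?(ltW d0) //= ler_pdivrMr.
have [r_eq0|r_neq0] := eqVneq r 0.
  exists 0 => //; apply/rowP => i; rewrite !mxE mulr0.
  by apply/eqP; have := xr i; rewrite r_eq0 normr_le0 eq_sym.
have r_gt0 : 0 < r by rewrite lt_neqAle eq_sym r_neq0.
exists ((d / r) *: x); last first.
  by rewrite scalerA mulrA divfK ?gt_eqF // mulfV // scale1r.
apply: dX => i; rewrite mxE normrM ger0_norm ?divr_ge0 ?(ltW d0) //.
by rewrite mulrAC ler_pdivrMr // ler_pM2l.
Qed.

(** Of the two extra levels, one absorbs the rounding of [b] to an integer vector: by the hypothesis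
    on [d], one step of the scale [s * lambda * (1 - lambda)] contains [cube 1]. The other comes
    from rounding a real level up to a natural number. *)
Lemma signed_join_shift (R : realType) (n : nat) (lambda s d : R) (X : set 'rV[R]_n)
    (i : nat) (z : 'rV[R]_n) :
  0 < lambda < 1 -> 0 < s -> 0 < d -> 1 <= s * lambda * (1 - lambda) * d ->
  convex_set X -> @cube R n d `<=` X ->
  dilate (i%:R * s) (signed_join lambda X) z ->
  exists q : 'rV[R]_n, (forall c, q 0 c \is a Num.int) /\
    forall m u, (i <= m)%N -> dilate ((m - i)%:R * (s * lambda * (1 - lambda))) X u ->
      exists2 j, (j <= m + 2)%N &
        dilate (j%:R * (s * (1 - lambda))) X (z + (u + q)) /\
        dilate ((m + 2 - j)%:R * (s * lambda)) X (u + q).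
Proof.
move=> /andP[l0 l1] s0 d0 sd cX dX [_ [t [a [b [/andP[t0 t1] Xa Xb ->]]]] <-].
have X0 : X 0 by apply: dX => c; rewrite mxE normr0 ltW.
have tl : 0 <= 1 - t by rewrite subr_ge0.
have ll : 0 < 1 - lambda by rewrite subr_gt0.
set v := (i%:R * s) *: b; have [q [qint qv]] := int_translate v.
exists q; split => // m u im Du.
set e := s * lambda * (1 - lambda) in sd Du *.
have e0 : 0 < e by rewrite !mulr_gt0.
have qv1 : dilate e X (q - v).
  apply: (@cube_sub_dilate _ _ 1 d) => // [|c]; first by rewrite ler01.
  by have := qv c; rewrite !mxE ler_norml => /andP[? ?]; apply/andP; split; lra.
have mi0 : 0 <= ((m - i)%:R : R) by rewrite ler0n.
have w : dilate ((m - i)%:R * e + e) X (u + (q - v)).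
  by apply: dilateD => //; rewrite ?mulr_ge0 // ltW.
have mE : m%:R = (m - i)%:R + i%:R :> R by rewrite -natrD subnK.
have i0 : 0 <= (i%:R : R) by rewrite ler0n.
(* [r] is the real level of [z + (u + q)], and [m + 1 - r] is that of [u + q]. *)
set r := i%:R * (1 - t) + ((m - i)%:R + 1) * lambda.
have r0 : 0 <= r by rewrite addr_ge0 // mulr_ge0 // ?addr_ge0 // ltW.
have r'0 : 0 <= i%:R * t + ((m - i)%:R + 1) * (1 - lambda).
  by rewrite addr_ge0 // mulr_ge0 ?(ltW ll) // addr_ge0.
have rm : r <= m%:R + 1 by rewrite -subr_ge0 mE /r; apply: le_trans r'0 _; lra.
have jr : (Num.truncn r)%:R <= r by rewrite truncn_le.
have rj : r < (Num.truncn r).+1%:R by exact: truncnS_gt.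
have jm : ((Num.truncn r).+1 <= m + 2)%N.
  rewrite addn2 ltnS -(ler_nat R) -[m.+1]addn1 natrD; exact: le_trans jr rm.
(* Rounding up gives [r <= j] for the first point, and still [m + 1 - r <= m + 2 - j] for the
   second. *)
exists (Num.truncn r).+1 => //; split.
  have -> : (i%:R * s) *: (a - b) + (u + q) = (i%:R * s) *: a + (u + (q - v)).
    by apply/rowP => c; rewrite /v !mxE; ring.
  apply: (@dilate_le _ _ (i%:R * s * ((1 - t) * (1 - lambda)) + ((m - i)%:R * e + e))) => //.
    have -> : i%:R * s * ((1 - t) * (1 - lambda)) + ((m - i)%:R * e + e) =
      r * (s * (1 - lambda)) by rewrite /r /e; ring.
    by apply/andP; split; [rewrite !mulr_ge0 ?(ltW s0) ?(ltW ll) |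
      rewrite ler_wpM2r ?(ltW rj) // mulr_ge0 ?(ltW s0) ?(ltW ll)].
  apply: dilateD => //; last exact: dilate_dilate.
    by rewrite !mulr_ge0 // ltW.
  by rewrite addr_ge0 // ?mulr_ge0 // ltW.
have -> : u + q = v + (u + (q - v)) by apply/rowP => c; rewrite !mxE; ring.
apply: (@dilate_le _ _ (i%:R * s * (t * lambda) + ((m - i)%:R * e + e))) => //.
  have -> : i%:R * s * (t * lambda) + ((m - i)%:R * e + e) =
    (m%:R + 1 - r) * (s * lambda) by rewrite mE /r /e; ring.
  rewrite !mulr_ge0 ?subr_ge0 ?(ltW s0) ?(ltW l0) //= ler_wpM2r //.
    by rewrite mulr_ge0 // ltW.
  by rewrite natrB // natrD -[(Num.truncn r).+1]addn1 natrD; lra.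
apply: dilateD => //; last exact: dilate_dilate.
  by rewrite !mulr_ge0 // ltW.
by rewrite addr_ge0 // ?mulr_ge0 // ltW.
Qed.

(** * The volume [Vol] and its upper bounds by integer points *)

Lemma valid_piece_vol_ge0 (R : realType) (n : nat) (o : option ('rV[R]_n * 'rV[R]_n)) :
  valid_piece o -> (0 <= piece_vol o)%E.
Proof.
by case: o => //= ab ab_le; rewrite lee_fin prodr_ge0 // => i _; rewrite subr_ge0.
Qed.

Lemma Vol_ge0 (R : realType) (n : nat) (A : set 'rV[R]_n) : (0 <= Vol A)%E.
Proof.
apply: le_ereal_inf_tmp => _ [c [cv _ ->]].
by apply: nneseries_ge0 => k _ _; exact: valid_piece_vol_ge0.
Qed.

Lemma le_Vol (R : realType) (n : nat) (A B : set 'rV[R]_n) :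
  A `<=` B -> (Vol A <= Vol B)%E.
Proof.
move=> AB; apply: ereal_inf_le_tmp => _ [c [cv Bc ->]]; exists c; split => //.
exact: subset_trans Bc.
Qed.

(** The reflection of a box exchanges its corners. This serves the case [lambda = 1]. *)
Lemma Vol_dilateN1 (R : realType) (n : nat) (A : set 'rV[R]_n) :
  (Vol (dilate (- 1) A) <= Vol A)%E.
Proof.
apply: ereal_inf_le_tmp => _ [c [cv Ac ->]].
exists (fun k => omap (fun ab => (- ab.2, - ab.1)) (c k)); split.
- move=> k; have := cv k; case: (c k) => //= ab ab_le i.
  by rewrite !mxE lerN2.
- move=> _ [x Ax <-]; have [k _ ck] := Ac _ Ax; exists k => //; move: ck.
  case: (c k) => //= ab xab i; rewrite !mxE mulN1r !lerN2 andbC; exact: xab.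
- apply: eq_eseriesr => k _; case: (c k) => //= ab; congr (_%:E).
  by apply: eq_bigr => i _; rewrite !mxE opprK addrC.
Qed.

(** [X] is covered by the cubes of side [1 / s] with lower corner [q / s], where [q] runs through
    the integer points of [Y]. *)
Lemma Vol_le_lat (R : realType) (n N : nat) (s : R) (X Y : set 'rV[R]_n) :
  0 < s -> Y `<=` @cube R n N%:R ->
  (forall x q : 'rV[R]_n, X x -> (forall c, q 0 c <= s * x 0 c <= q 0 c + 1) -> Y q) ->
  (Vol X <= ((lat N Y)%:R / s ^+ n)%:E)%E.
Proof.
move=> s0 YN XY.
set S := [set t : {ffun 'I_n -> 'I_N.*2.+1} | `[< Y (gpt R t) >]]%SET.
pose box (t : {ffun 'I_n -> 'I_N.*2.+1}) :=
  (s^-1 *: gpt R t, s^-1 *: (gpt R t + const_mx 1)).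
(* The finite list of cubes is padded with [None], of volume 0, to a sequence. *)
pose c k := nth None [seq Some (box t) | t <- enum S] k.
have box_volE t : box_vol (box t).1 (box t).2 = (s ^+ n)^-1.
  rewrite /box_vol (eq_bigr (fun=> s^-1)) => [|i _].
    by rewrite prodr_const card_ord exprVn.
  by rewrite !mxE; ring.
have cE k : c k = None \/ exists t, c k = Some (box t).
  rewrite /c; have [kS|kS] := ltnP k (size (enum S)); last first.
    by left; rewrite nth_default // size_map.
  case E : (enum S) kS => [//|t0 r] kS; right.
  by exists (nth t0 (t0 :: r) k); rewrite (nth_map t0).
have cv k : valid_piece (c k).
  have [->//|[t ->]] := cE k => i /=; rewrite !mxE ler_pM2l ?invr_gt0 //.
  by rewrite lerDl ler01.
apply: le_trans (_ : (\sum_(0 <= k <oo) piece_vol (c k) <= _)%E); last first.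
  rewrite (nneseries_split 0 #|S|) => [|k _]; last exact: valid_piece_vol_ge0.
  rewrite [X in (_ + X)%E]eseries0 => [|k kS _]; last first.
    by rewrite /c nth_default // size_map -cardE.
  rewrite adde0 add0n big_mkord (eq_bigr (fun=> ((s ^+ n)^-1)%:E)).
    by rewrite sumEFin sumr_const card_ord mulr_natl lexx.
  move=> k _; rewrite /c; have kS : (k < size (enum S))%N by rewrite -cardE.
  case E : (enum S) kS => [//|t0 r] kS.
  by rewrite (nth_map t0) //= box_volE.
apply: ereal_inf_lbound; exists c; split => // x Xx.
have [q [qint qx]] := int_translate (s *: x).
have qx' i : q 0 i <= s * x 0 i <= q 0 i + 1 by have := qx i; rewrite mxE.
have Yq := XY x q Xx qx'.
have [t tq] := gpt_onto qint (YN q Yq).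
have tS : t \in enum S by rewrite mem_enum finset.in_set tq; apply/asboolP.
exists (index t (enum S)) => //.
rewrite /c (nth_map t) ?index_mem // nth_index //= => i.
have /andP[q1 q2] := qx' i.
by rewrite tq !mxE ler_pdivrMl // ler_pdivlMl // q1 q2.
Qed.

(** Scaling by [s - 1/d] leaves room for [X / d], which contains [cube 1] and so absorbs the
    rounding. *)
Lemma Vol_le_lat_dilate (R : realType) (n N : nat) (s d : R) (X : set 'rV[R]_n) :
  convex_set X -> 0 < d -> @cube R n d `<=` X -> 1 < s * d ->
  dilate s X `<=` @cube R n N%:R ->
  (Vol X <= ((lat N (dilate s X))%:R / (s - d^-1) ^+ n)%:E)%E.
Proof.
move=> cX d0 dX sd sN.
have s' : 0 < s - d^-1 by rewrite subr_gt0 -(ltr_pM2r d0) mulVf ?gt_eqF.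
apply: Vol_le_lat => // x q Xx qx.
have -> : s = (s - d^-1) + d^-1 by rewrite subrK.
have -> : q = (s - d^-1) *: x + (q - (s - d^-1) *: x) by rewrite subrKC.
have d'0 : 0 <= d^-1 by rewrite invr_ge0 ltW.
apply: dilateD => //; [exact: ltW | by exists x |].
apply: (@cube_sub_dilate _ _ 1 d) => // [|c].
  by rewrite ler01 mulVf ?gt_eqF //=.
by have := qx c; rewrite !mxE ler_norml => /andP[? ?]; apply/andP; split; lra.
Qed.

(** * Upper bounds for the number of integer points near a compact set *)

Lemma card_ord_interval (R : realType) (m : nat) (F : {pred 'I_m}) (a b : R) :
  0 <= b - a + 1 -> (forall k, k \in F -> a <= k%:R <= b) -> #|F|%:R <= b - a + 1.
Proof.
move=> ab0 Fab; have [F0|/card_gt0P[k0 Fk0]] := posnP #|F|; first by rewrite F0.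
case: (arg_minnP (@nat_of_ord m) Fk0) => k1 Fk1 k1min.
case: (arg_maxnP (@nat_of_ord m) Fk0) => k2 Fk2 k2max.
have le12 : (k1 <= k2)%N by exact: k1min.
have : (#|F| <= (k2 - k1).+1)%N.
  rewrite -(size_iota k1 (k2 - k1).+1) cardE -(size_map (@nat_of_ord m)).
  apply: uniq_leq_size; first by rewrite (map_inj_uniq val_inj) enum_uniq.
  move=> _ /mapP[k kF ->]; move: kF; rewrite mem_enum => Fk.
  by rewrite mem_iota; have := k1min k Fk; have := k2max k Fk; lia.
rewrite -(ler_nat R) => /le_trans; apply.
rewrite -addn1 natrD natrB //.
by have /andP[? ?] := Fab _ Fk1; have /andP[? ?] := Fab _ Fk2; lra.
Qed.

Lemma lat_box_le (R : realType) (n N : nat) (a b : 'rV[R]_n) :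
  (forall i, 0 <= b 0 i - a 0 i + 1) ->
  (lat N [set x | in_box a b x])%:R <= \prod_(i < n) (b 0 i - a 0 i + 1).
Proof.
move=> ab; pose F i : pred 'I_N.*2.+1 := fun k => a 0 i <= k%:R - N%:R <= b 0 i.
(* The integer points of a box form a product of one-dimensional families. *)
have -> : lat N [set x | in_box a b x] = (\prod_(i < n) #|F i|)%N.
  transitivity #|(family F : simpl_pred {ffun 'I_n -> 'I_N.*2.+1})|; last first.
    by rewrite card_family foldrE big_map big_enum.
  apply: eq_card => t; rewrite finset.in_set; apply/asboolP/familyP => [tb i|tF i].
    by have := tb i; rewrite mxE.
  by rewrite mxE; exact: tF.
rewrite natr_prod; apply: ler_prod => i _; rewrite ler0n /=.
apply: le_trans (@card_ord_interval R _ (F i) (a 0 i + N%:R) (b 0 i + N%:R) _ _) _.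
- by have := ab i; lra.
- by move=> k; rewrite unfold_in => /andP[? ?]; apply/andP; split; lra.
- lra.
Qed.

Lemma lat_bigcup_le (R : realType) (n N m : nat) (Y : set 'rV[R]_n)
    (Z : nat -> set 'rV[R]_n) :
  (forall x, Y x -> exists2 k, (k < m)%N & Z k x) ->
  (lat N Y <= \sum_(k < m) lat N (Z k))%N.
Proof.
move=> YZ; rewrite /lat; under eq_bigr do rewrite -sum1_card big_mkcond /=.
rewrite exchange_big /= -sum1_card big_mkcond /=; apply: leq_sum => t _.
rewrite finset.in_set; case: asboolP => // /YZ[k km Zk].
rewrite (bigD1 (Ordinal km)) //= finset.in_set.
by move/asboolP: Zk => ->; rewrite addSn ltnS.
Qed.

(** The Minkowski sum [K + [-d, d]^n]. *)
Definition thicken (R : realType) (n : nat) (d : R) (K : set 'rV[R]_n) : set 'rV[R]_n :=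
  [set x | exists2 y, K y & @cube R n d (x - y)].

(** Open enlargement of a covering box, for extracting finite subcovers. *)
Definition piece_nbhs (R : realType) (n : nat) (h : R)
    (o : option ('rV[R]_n * 'rV[R]_n)) : set 'rV[R]_n :=
  if o is Some ab then [set x | forall i, ab.1 0 i - h < x 0 i < ab.2 0 i + h] else set0.

Lemma open_piece_nbhs (R : realType) (n : nat) (h : R) (o : option ('rV[R]_n * 'rV[R]_n)) :
  open (piece_nbhs h o).
Proof.
case: o => [[a b]|]; last exact: open0.
rewrite openE => x xab.
apply: (@filter_forall _ _ (fun i => [set y : 'rV[R]_n | a 0 i - h < y 0 i < b 0 i + h])
  (nbhs x)) => i.
have xi : x 0 i \in `]a 0 i - h, b 0 i + h[ by rewrite in_itv; exact: xab.
have := @coord_continuous R 1 n 0 i x _ (near_in_itvoo xi).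
by rewrite nbhs_simpl /=; apply: (@filterS _ (nbhs x)) => y /=; rewrite in_itv.
Qed.

Lemma compact_nat_cover (R : realType) (n : nat) (K : set 'rV[R]_n)
    (O : nat -> set 'rV[R]_n) :
  compact K -> (forall k, open (O k)) -> K `<=` \bigcup_k O k ->
  exists m, forall x, K x -> exists2 k, (k < m)%N & O k x.
Proof.
rewrite compact_cover => cK oO KO.
have [D _ KD] := cK nat setT O (fun k _ => oO k) KO.
exists (\max_(k <- finmap.enum_fset D) k).+1 => x /KD[k kD Okx]; exists k => //.
by rewrite ltnS; exact: (@leq_bigmax_seq _ _ xpredT id).
Qed.

Lemma compact_sub_cube (R : realType) (n : nat) (K : set 'rV[R]_n) :
  compact K -> exists2 r, 0 <= r & K `<=` @cube R n r.
Proof.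
(* [O k] is the open cube of half-side [k + 1] around 0. *)
move=> cK; pose O k := piece_nbhs k.+1%:R (Some (0 : 'rV[R]_n, 0 : 'rV[R]_n)).
have oO k : open (O k) by exact: open_piece_nbhs.
have [|m mK] := compact_nat_cover cK oO.
  move=> x _; exists (Num.truncn (\sum_i `|x 0 i|)) => // i /=.
  rewrite !mxE sub0r add0r -ltr_norml (le_lt_trans _ (truncnS_gt _)) //.
  by rewrite (bigD1 i) //= lerDl sumr_ge0.
exists m%:R => // x /mK[k km xk] i; have := xk i; rewrite !mxE sub0r add0r -ltr_norml.
by move=> /ltW/le_trans; apply; rewrite ler_nat.
Qed.

Lemma thicken_convex (R : realType) (n : nat) (d : R) (K : set 'rV[R]_n) :
  convex_set K -> convex_set (thicken d K).
Proof.
move=> cK x x' t [y Ky xy] [y' Ky' xy'] t01; exists ((1 - t) *: y + t *: y').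
  exact: cK.
have /andP[t0 t1] := t01 => i; have := xy i; have := xy' i; rewrite !mxE.
move=> dx' dx; have t1' : 0 <= 1 - t by rewrite subr_ge0.
have -> : (1 - t) * x 0 i + t * x' 0 i - ((1 - t) * y 0 i + t * y' 0 i) =
  (1 - t) * (x 0 i - y 0 i) + t * (x' 0 i - y' 0 i) by ring.
rewrite (le_trans (ler_normD _ _)) // !normrM (ger0_norm t0) (ger0_norm t1').
have -> : d = (1 - t) * d + t * d by ring.
by rewrite lerD // ler_wpM2l.
Qed.

(* The factor 5 leaves room for two enlargements of a box by h on each side and for
   the + 1 in lat_box_le. *)
Lemma prod_enlarge (R : realType) (n : nat) (l : 'I_n -> R) (e : R) :
  0 < e -> exists2 h : R, 0 < h & \prod_i (l i + 5 * h) <= \prod_i l i + e.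
Proof.
(* Read as a polynomial in [h], the product is continuous at 0. *)
move=> e0; pose p : {poly R} := \prod_i ((l i)%:P + 5%:P * 'X).
have pE x : p.[x] = \prod_i (l i + 5 * x).
  by rewrite horner_prod; apply: eq_bigr => i _; rewrite !hornerE.
have /cvgrPdist_le/(_ e e0)/nbhs_ballP[r /= r0 pr] := continuous_horner (p := p) (x := 0).
have r2 : 0 < r / 2 by rewrite divr_gt0.
exists (r / 2) => //.
have := pr (r / 2); rewrite /ball /= sub0r normrN (gtr0_norm r2).
rewrite ltr_pdivrMr // ltr_pMr // ltr1n => /(_ isT).
rewrite !pE; under [X in `|X - _|]eq_bigr do rewrite mulr0 addr0.
by rewrite ler_norml => /andP[]; lra.
Qed.

(** For [d <= h] the thickened neighbourhood lies in the box enlarged by [2h] on each side, and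
    [1 <= s * d <= s * h] turns the [+ 1] of [lat_box_le] into one more [h]. *)
Lemma piece_enlarge (R : realType) (n : nat) (o : option ('rV[R]_n * 'rV[R]_n)) (e : R) :
  valid_piece o -> 0 < e ->
  exists h : R, 0 < h /\ forall s d N, 0 < s -> 1 <= s * d -> d <= h ->
    (((lat N (dilate s (thicken d (piece_nbhs h o))))%:R)%:E <=
      (s ^+ n)%:E * (piece_vol o + e%:E))%E.
Proof.
case: o => [[a b]|] /= ab e0; last first.
  exists 1; split => // s d N s0 sd d1; rewrite add0e -EFinM lee_fin.
  have -> : lat N (dilate s (thicken d (set0 : set 'rV[R]_n))) = 0%N.
    by apply: eq_card0 => t; rewrite finset.in_set; apply/asboolP => -[_ [y []]].
  by rewrite mulr_ge0 ?exprn_ge0 // ltW.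
have [h h0 hb] := prod_enlarge (fun i => b 0 i - a 0 i) e0.
exists h; split => // s d N s0 sd dh; rewrite -EFinD -EFinM lee_fin.
have sh : 1 <= s * h by apply: le_trans sd _; rewrite ler_pM2l.
have lab i : 0 <= s * (b 0 i - a 0 i) by rewrite mulr_ge0 ?subr_ge0 ?(ltW s0).
pose a' := \row_i (s * (a 0 i - 2 * h)); pose b' := \row_i (s * (b 0 i + 2 * h)).
apply: le_trans (_ : (lat N [set x | in_box a' b' x])%:R <= _).
  rewrite ler_nat; apply: latS => _ [y [z zab yz] <-] i; rewrite !mxE !ler_pM2l //.
  have := yz i; rewrite !mxE ler_norml; have := zab i => /= /andP[? ?] /andP[? ?].
  by apply/andP; split; lra.
apply: le_trans (@lat_box_le R n N a' b' _) _.
  by move=> i; rewrite !mxE; have := lab i; lra.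
apply: le_trans (_ : s ^+ n * \prod_i (b 0 i - a 0 i + 5 * h) <= _); last first.
  by rewrite ler_pM2l ?exprn_gt0.
rewrite -[X in s ^+ X](card_ord n) -prodr_const -big_split /=.
by apply: ler_prod => i _; rewrite !mxE; have := lab i => ?; apply/andP; split; lra.
Qed.

Lemma common_lower_bound (R : realType) (h : nat -> R) (m : nat) :
  (forall k, 0 < h k) -> exists2 d, 0 < d & forall k, (k < m)%N -> d <= h k.
Proof.
move=> h0; elim: m => [|m [d d0 dh]]; first by exists 1.
exists (Num.min d (h m)); first by rewrite lt_min d0 h0.
move=> k; rewrite ltnS leq_eqVlt => /predU1P[->|/dh dk]; rewrite ge_min ?lexx ?orbT //.
by rewrite dk.
Qed.

(** A cover of total volume [S < v] leaves the slack [e = v - S]; box [k] is enlarged at a cost of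
    [e / 2^(k+1)]. Compactness keeps finitely many enlarged boxes, so that one [d] suits them
    all. *)
Lemma lat_thicken_le (R : realType) (n : nat) (K : set 'rV[R]_n) (v : R) :
  compact K -> (Vol K < v%:E)%E ->
  exists d : R, 0 < d /\ forall s N, 0 < s -> 1 <= s * d ->
    (lat N (dilate s (thicken d K)))%:R <= s ^+ n * v.
Proof.
move=> cK /ereal_inf_lt[_ [c [cv Kc ->]]] sum_v.
have pc0 k : (0 <= piece_vol (c k))%E by exact: valid_piece_vol_ge0.
set S := (\sum_(0 <= k <oo) _)%E in sum_v.
have S0 : (0 <= S)%E by exact: nneseries_ge0.
have Sfin : S \is a fin_num.
  by rewrite ge0_fin_numE // (lt_trans sum_v) // ltry.
pose e := v - fine S.
have e0 : 0 < e by rewrite subr_gt0 -lte_fin fineK.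
have e2 k : 0 < e / (2 ^ k.+1)%:R by rewrite divr_gt0 // ltr0n expn_gt0.
have /choice[h hP] := fun k => piece_enlarge (cv k) (e2 k).
have oO k : open (piece_nbhs (h k) (c k)) by exact: open_piece_nbhs.
have [|m mK] := compact_nat_cover cK oO.
  move=> x /Kc[k _ ck]; exists k => //; have [hk0 _] := hP k; move: ck.
  by case: (c k) => //= ab ck i; have /andP[? ?] := ck i; apply/andP; split; lra.
have [d d0 dh] := common_lower_bound m (fun k => (hP k).1).
exists d; split => // s N s0 sd.
have sn0 : (0 <= (s ^+ n)%:E)%E by rewrite lee_fin exprn_ge0 // ltW.
rewrite -lee_fin.
apply: le_trans (_ : ((s ^+ n)%:E * \sum_(k < m) (piece_vol (c k) + (e / (2 ^ k.+1)%:R)%:E) <= _)%E).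
  rewrite ge0_sume_distrr => [|k _]; last by rewrite adde_ge0 // lee_fin ltW.
  apply: le_trans (_ : ((\sum_(k < m)
    lat N (dilate s (thicken d (piece_nbhs (h k) (c k)))))%:R%:E <= _)%E).
    rewrite lee_fin ler_nat.
    apply: (@lat_bigcup_le R n N m _ (fun k => dilate s (thicken d (piece_nbhs (h k) (c k))))).
    move=> _ [y [z /mK[k km ck] yz] <-]; exists k => //.
    by exists y => //; exists z.
  rewrite natr_sum -sumEFin; apply: lee_sum => k _.
  by apply: (hP k).2 => //; exact: dh.
rewrite EFinM; apply: lee_wpmul2l => //.
rewrite -(big_mkord xpredT (fun k => piece_vol (c k) + (e / (2 ^ k.+1)%:R)%:E)%E).
apply: le_trans (nneseries_lim_ge _ _) _.
  by move=> k _ _; rewrite adde_ge0 // lee_fin ltW.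
apply: le_trans (epsilon_trick _ pc0 (ltW e0)) _.
by rewrite -/S -(fineK Sfin) -EFinD /e subrKC lexx.
Qed.

(** * Positivity of the volume *)

Lemma lat_cube_ge (R : realType) (n N : nat) (r : R) (x : 'rV[R]_n) (Y : set 'rV[R]_n) :
  1 <= r -> (forall y, @cube R n r (y - x) -> Y y) -> Y `<=` @cube R n N%:R ->
  ((Num.truncn r) ^ n <= lat N Y)%N.
Proof.
move=> r1 xY YN; have [q [qint qx]] := int_translate x.
set k := Num.truncn r; have kr : k%:R <= r by rewrite truncn_le (le_trans ler01).
(* These [k ^ n] integer points stay in the cube: their coordinates minus those of [x] lie between
   [-1] and [r - 1]. *)
pose p (f : {ffun 'I_n -> 'I_k}) : 'rV[R]_n := q + \row_i (f i)%:R.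
have pY f : Y (p f).
  apply: xY => i; rewrite !mxE ler_norml.
  have /andP[? ?] := qx i; have f0 : 0 <= ((f i)%:R : R) by [].
  have fk : (f i)%:R + 1 <= k%:R :> R by rewrite natr1 ler_nat.
  by apply/andP; split; lra.
have pint f i : p f 0 i \is a Num.int by rewrite !mxE rpredD // natr_int.
have /choice[g gP] := fun f => gpt_onto (pint f) (YN _ (pY f)).
rewrite -[X in (X ^ _)%N](card_ord k) -[X in (_ ^ X)%N](card_ord n) -card_ffun.
rewrite -cardsT -(@card_imset _ _ g); last first.
  move=> f f' ff'; apply/ffunP => i; apply/val_inj/eqP.
  have : p f = p f' by rewrite -!gP ff'.
  by move=> /rowP/(_ i); rewrite !mxE => /addrI/eqP; rewrite eqr_nat.
apply: subset_leq_card; apply/fintype.subsetP => _ /imsetP[f _ ->].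
by rewrite finset.in_set gP; apply/asboolP.
Qed.

Lemma dilate_sub_cube (R : realType) (n : nat) (s t r : R) (X : set 'rV[R]_n) :
  0 <= s -> X `<=` @cube R n r -> s * r <= t -> dilate s X `<=` @cube R n t.
Proof.
move=> s0 Xr st _ [x /Xr xr <-] i; rewrite mxE normrM (ger0_norm s0).
by apply: le_trans st; rewrite ler_wpM2l.
Qed.

Lemma thicken_sub_cube (R : realType) (n : nat) (d r : R) (K : set 'rV[R]_n) :
  K `<=` @cube R n r -> thicken d K `<=` @cube R n (r + d).
Proof.
move=> Kr x [y /Kr yr xy] i; rewrite -(subrKC (y 0 i) (x 0 i)).
by apply: le_trans (ler_normD _ _) _; apply: lerD => //; have := xy i; rewrite !mxE.
Qed.

Lemma sub_thicken (R : realType) (n : nat) (d : R) (K : set 'rV[R]_n) :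
  0 <= d -> K `<=` thicken d K.
Proof. by move=> d0 x Kx; exists x => // i; rewrite subrr mxE normr0. Qed.

(** Were the volume 0, a dilate of a thickened [K] would have at most [(s * r / 4)^n] integer
    points, while a cube inside [K] already gives [(truncn (s * r))^n]. Positivity allows cancelling
    [Vol K] in the final contradiction. *)
Lemma Vol_gt0 (R : realType) (n : nat) (K : set 'rV[R]_n) :
  (0 < n)%N -> compact K -> (interior K) !=set0 -> (0 < Vol K)%E.
Proof.
move=> n0 cK [x /nbhs_ballP[e /= e0 eK]]; rewrite ltNge; apply/negP => VK.
pose r := e / 2; have r0 : 0 < r by rewrite divr_gt0.
have rK y : @cube R n r (y - x) -> K y.
  move=> xy; apply: eK; split => // i j; rewrite (ord1 i) /ball /= distrC.
  have := xy j; rewrite !mxE => /le_lt_trans; apply.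
  by rewrite ltr_pdivrMr // ltr_pMr // ltr1n.
have r4 : 0 < r / 4 by rewrite divr_gt0.
have [|d [d0 dP]] := @lat_thicken_le R n K ((r / 4) ^+ n) cK.
  by apply: le_lt_trans VK _; rewrite lte_fin exprn_gt0.
have [r1 r10 Kr1] := compact_sub_cube cK.
(* The two summands give [s * r >= 2] and [s * d >= 1]. *)
pose s := 2 / r + d^-1.
have s0 : 0 < s by rewrite addr_gt0 ?divr_gt0 ?invr_gt0.
have sr : 2 <= s * r.
  by rewrite mulrDl divfK ?gt_eqF // lerDl mulr_ge0 ?invr_ge0 ?ltW.
have sd : 1 <= s * d.
  by rewrite mulrDl mulVf ?gt_eqF // lerDr mulr_ge0 ?divr_ge0 ?ltW.
pose N := (Num.truncn (s * (r1 + d))).+1.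
have YN : dilate s (thicken d K) `<=` @cube R n N%:R.
  apply: dilate_sub_cube (ltW s0) (thicken_sub_cube Kr1) _.
  exact: ltW (truncnS_gt _).
have sr1 : 1 <= s * r by apply: le_trans sr; rewrite ler1n.
have xY y : @cube R n (s * r) (y - s *: x) -> dilate s (thicken d K) y.
  move=> xy.
  exists (s^-1 *: y); last by rewrite scalerA mulfV ?gt_eqF // scale1r.
  apply: (sub_thicken (ltW d0)); apply: rK => i; have := xy i; rewrite !mxE.
  have -> : s^-1 * y 0 i - x 0 i = s^-1 * (y 0 i - s * x 0 i).
    by rewrite mulrBr mulKf ?gt_eqF.
  by rewrite normrM gtr0_norm ?invr_gt0 // ler_pdivrMl.
have := lat_cube_ge sr1 xY YN.
rewrite -(ler_nat R) natrX => /le_trans/(_ (dP s N s0 sd)); apply/negP.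
have sr4 : 0 <= s * (r / 4) by exact: mulr_ge0 (ltW s0) (ltW r4).
rewrite -ltNge -exprMn ltr_pXn2r ?nnegrE ?ler0n //.
have := truncnS_gt (s * r); rewrite -natr1; lra.
Qed.

(** * Polynomial growth of the convolution sums *)

Lemma bernoulli_ge (R : realFieldType) (h : R) (l : nat) :
  0 <= h -> 1 + l%:R * h <= (1 + h) ^+ l.
Proof.
move=> h0; elim: l => [|l IH]; first by rewrite mul0r addr0 expr0.
rewrite exprS; apply: le_trans (ler_wpM2l _ IH); last by rewrite addr_ge0.
rewrite -natr1; have : 0 <= l%:R * h * h by rewrite !mulr_ge0.
lra.
Qed.

(** What remains on both sides once the counts at level [i] are compared with multiples of [i ^ n],
    up to level shifts. *)
Definition conv_pow (n M : nat) : nat := (\sum_(i < M.+1) i ^ n * (M - i) ^ n)%N.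

Lemma conv_pow_le (n M : nat) : (conv_pow n M <= M.+1 ^ (n + n).+1)%N.
Proof.
apply: leq_trans (_ : (\sum_(i < M.+1) M.+1 ^ (n + n) <= _)%N).
  apply: leq_sum => i _; rewrite expnD leq_mul //; case: n => // n.
    by rewrite leq_exp2r // ltnW.
  by rewrite leq_exp2r // (leq_trans (leq_subr _ _)).
by rewrite sum_nat_const card_ord expnS.
Qed.

(* If b < a, iterating the hypothesis makes conv_pow grow exponentially. *)
Lemma conv_pow_growth (R : realType) (a b : R) (n k : nat) :
  (0 < n)%N -> 0 <= b -> (forall M, a * (conv_pow n M)%:R <= b * (conv_pow n (M + k))%:R) ->
  a <= b.
Proof.
move=> n0 b0 ab; rewrite leNgt; apply/negP => ba.
have a0 : 0 < a by exact: le_lt_trans ba.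
(* Only [i = 1] contributes, because [n > 0]; the iteration starts from this value. *)
have Q2 : (conv_pow n 2)%:R = 1 :> R.
  by rewrite /conv_pow !big_ord_recl big_ord0 /= !exp0n // !exp1n muln0.
have iter j : a ^+ j <= b ^+ j * (conv_pow n (2 + j * k))%:R.
  elim: j => [|j IH]; first by rewrite !expr0 mul1r mul0n addn0 Q2.
  rewrite exprS; apply: le_trans (ler_wpM2l (ltW a0) IH) _.
  rewrite mulrCA exprSr -[in leRHS]mulrA ler_wpM2l ?exprn_ge0 //.
  by apply: le_trans (ab _) _; rewrite mulSn addnCA addnC.
have b_gt0 : 0 < b.
  rewrite lt_neqAle b0 andbT eq_sym; apply/eqP => b_eq0.
  by have := iter 1%N; rewrite b_eq0 !expr1 mul0r leNgt a0.
pose h := a / b - 1; have h0 : 0 < h by rewrite subr_gt0 ltr_pdivlMr // mul1r.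
(* [p] is the degree in [conv_pow_le], and [c] satisfies [3 + l * p.+1 * k <= l * c] for [l > 0].
   With [l * p.+1] iterations and [(1 + h)^l >= l * h] one gets [(l * h)^p.+1 <= (l * c)^p], which
   bounds [l]. *)
pose p := (n + n).+1; pose c := (3 + p.+1 * k)%N.
have key l : (0 < l)%N -> l%:R * h ^+ p.+1 <= c%:R ^+ p.
  move=> l0; have lp : 0 < (l%:R : R) ^+ p by rewrite exprn_gt0 // ltr0n.
  rewrite -(ler_pM2l lp) mulrA -exprSr -!exprMn -natrM.
  have lh : 0 <= l%:R * h by rewrite mulr_ge0 // ltW.
  apply: le_trans (_ : (1 + h) ^+ (l * p.+1) <= _).
    have h1 : 0 <= 1 + h by move: h0; clearbody h => h0; lra.
    rewrite exprM ler_pXn2r ?nnegrE ?exprn_ge0 //.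
    by apply: le_trans (bernoulli_ge _ (ltW h0)); rewrite lerDr.
  rewrite /h subrKC expr_div_n ler_pdivrMr ?exprn_gt0 // mulrC.
  apply: le_trans (iter _) _; rewrite ler_pM2l ?exprn_gt0 // -natrX ler_nat.
  apply: leq_trans (conv_pow_le _ _) _; rewrite leq_exp2r //.
  rewrite /c; nia.
pose l := (Num.truncn (c%:R ^+ p / h ^+ p.+1)).+1.
have := key l isT; rewrite -ler_pdivlMr ?exprn_gt0 // leNgt.
by rewrite truncnS_gt.
Qed.

(** * Comparison of the volumes *)

Lemma Vol_le_lat_level (R : realType) (n N j : nat) (w t d : R) (X : set 'rV[R]_n) :
  (0 < n)%N -> convex_set X -> 0 < d -> @cube R n d `<=` X -> 0 < t -> 1 < t * d ->
  0 <= w -> (w%:E <= Vol X)%E -> dilate (j%:R * t) X `<=` @cube R n N%:R ->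
  w * (j.-1%:R * t) ^+ n <= (lat N (dilate (j%:R * t) X))%:R.
Proof.
move=> n0 cX d0 dX t0 td w0 wX XN.
(* At [j = 0] also [j.-1 = 0], and the left side vanishes because [n > 0]. *)
case: j XN => [|j] XN; first by rewrite mul0r expr0n gtn_eqF // mulr0.
have jt : 1 < j.+1%:R * t * d.
  by apply: (lt_le_trans td); rewrite -mulrA ler_peMl ?ler1n // ltW // mulr_gt0.
have := le_trans wX (Vol_le_lat_dilate cX d0 dX jt XN); rewrite lee_fin.
(* As [t * d > 1], the loss [1/d] is less than one level, whence [j.-1]. *)
have jtd : j%:R * t <= j.+1%:R * t - d^-1.
  rewrite -natr1 mulrDl mul1r -addrA lerDl subr_ge0 -(ler_pM2r d0) mulVf ?gt_eqF //.
  exact: ltW.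
have jtd0 : 0 < j.+1%:R * t - d^-1.
  by rewrite subr_gt0 -(ltr_pM2r d0) mulVf ?gt_eqF.
rewrite ler_pdivlMr ?exprn_gt0 //; apply: le_trans; rewrite ler_wpM2l //.
by rewrite lerXn2r ?nnegrE // ?(ltW jtd0) // mulr_ge0 // ltW.
Qed.

(** Going up one level gives a scale of at least [t] even for [j = 0], so the counting hypothesis
    applies. *)
Lemma lat_level_le (R : realType) (n N j : nat) (v t d : R) (X : set 'rV[R]_n) :
  convex_set X -> X 0 -> 0 < t -> 0 < d -> 1 <= t * d ->
  (forall s, 0 < s -> 1 <= s * d -> (lat N (dilate s X))%:R <= s ^+ n * v) ->
  (lat N (dilate (j%:R * t) X))%:R <= (j.+1%:R * t) ^+ n * v.
Proof.
move=> cX X0 t0 d0 td Xv.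
apply: le_trans (_ : (lat N (dilate (j.+1%:R * t) X))%:R <= _).
  rewrite ler_nat; apply/latS/dilate_le => //.
  by rewrite mulr_ge0 ?(ltW t0) //= ler_wpM2r ?(ltW t0) // ler_nat.
apply: Xv; first by rewrite mulr_gt0 // ltr0n.
by apply: (le_trans td); rewrite -mulrA ler_peMl ?ler1n // ltW // mulr_gt0.
Qed.

(** Without its two end terms the right-hand sum is [conv_pow n M]. *)
Lemma conv_pow_shift_ge (n M : nat) :
  (conv_pow n M <= \sum_(i < M.+3) i.-1 ^ n * (M.+2 - i).-1 ^ n)%N.
Proof.
rewrite big_ord_recl big_ord_recr /=.
apply: leq_trans (leq_addl _ _); apply: leq_trans (leq_addr _ _).
by apply: leq_sum => i _; rewrite /bump /= add1n /= subSS subSn // -ltnS.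
Qed.

Lemma conv_pow_shift_le (n M : nat) :
  (\sum_(i < M.+1) i.+1 ^ n * (M - i).+1 ^ n <= conv_pow n M.+2)%N.
Proof.
rewrite /conv_pow [leqRHS]big_ord_recl [in leqRHS]big_ord_recr /=.
apply: leq_trans (leq_addl _ _); apply: leq_trans (leq_addr _ _).
by apply: leq_sum => i _; rewrite /bump /= add1n /= subSS subSn // -ltnS.
Qed.

(** With [X] a thickening of [K], the counts for [signed_join lambda X] and [X] at scales [s] and
    [s * e] are bounded below through [w] and [V], those for [X] at scales [s * (1 - lambda)] and
    [s * lambda] above through [v]. Both pairs of scales have product [s * (s * e)], so this factor
    cancels and [conv_pow_growth] applies. *)
Lemma signed_join_volume_product (R : realType) (n : nat) (lambda v w V : R)
    (K : set 'rV[R]_n) :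
  (0 < n)%N -> compact K -> convex_set K -> K 0 -> 0 < lambda < 1 ->
  0 <= w -> (w%:E <= Vol (signed_join lambda K))%E ->
  0 <= V -> (V%:E <= Vol K)%E -> (Vol K < v%:E)%E ->
  w * V <= v * v.
Proof.
move=> n0 cptK cK K0 l01 w0 wM V0 VK Kv.
have /andP[l0 l1] := l01; have m0 : 0 < 1 - lambda by rewrite subr_gt0.
have l01' : 0 <= lambda <= 1 by rewrite (ltW l0) (ltW l1).
have [d [d0 dP]] := lat_thicken_le cptK Kv.
have [r1 r10 Kr1] := compact_sub_cube cptK.
pose r := r1 + d; have r0 : 0 <= r by rewrite addr_ge0 // ltW.
pose X := thicken d K.
have XP s N : 0 < s -> 1 <= s * d -> (lat N (dilate s X))%:R <= s ^+ n * v by exact: dP.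
have KX : K `<=` X by exact: sub_thicken (ltW d0).
have X0 : X 0 by exact: KX.
have cX : convex_set X by exact: thicken_convex.
have Xr : X `<=` @cube R n r by exact: thicken_sub_cube.
have dX : @cube R n d `<=` X by move=> x xd; exists 0 => //; rewrite subr0.
have wX : (w%:E <= Vol (signed_join lambda X))%E.
  by apply: le_trans wM _; apply/le_Vol/signed_joinS.
have VX : (V%:E <= Vol X)%E by apply: le_trans VK _; exact: le_Vol.
have v0 : 0 <= v by rewrite -lee_fin (le_trans (Vol_ge0 K)) // ltW.
clearbody X.
pose e := lambda * (1 - lambda); have e0 : 0 < e by rewrite mulr_gt0.
(* This makes [s * e * d = 2], so that even at the smallest scale [s * e] one level contains
   [cube 2], with room beyond the rounding error. *)
pose s := 2 / (d * e); have s0 : 0 < s by rewrite divr_gt0 // mulr_gt0.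
have sed : s * e * d = 2.
  by rewrite -mulrA [e * d]mulrC divfK // mulf_neq0 // gt_eqF.
have sE : s * lambda * (1 - lambda) = s * e by rewrite -mulrA.
have eE : e = lambda * (1 - lambda) by [].
clearbody s e.
have cM := signed_join_convex l01' cX.
have d'0 : 0 < (1 - lambda) * d by rewrite mulr_gt0.
have dM : @cube R n ((1 - lambda) * d) `<=` signed_join lambda X.
  apply: subset_trans (dilate_sub_signed_join X0).
  apply: (@cube_sub_dilate _ _ _ d) => //.
  by rewrite lexx andbT ltW.
have Mr := signed_join_cube l01' r0 Xr.
have se0 : 0 < s * e by rewrite mulr_gt0.
have sl0 : 0 < s * lambda by rewrite mulr_gt0.
have sm0 : 0 < s * (1 - lambda) by rewrite mulr_gt0.
have sdm : 2 <= s * ((1 - lambda) * d).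
  by rewrite -sed eE -!mulrA (ler_pM2l s0) ler_piMl ?(ltW d'0) ?(ltW l1).
have sdl : 2 <= s * lambda * d.
  by rewrite -sed eE -!mulrA (ler_pM2l s0) (ler_pM2l l0) ler_piMl ?(ltW d0) // gerBl ltW.
have mono t (Y : set 'rV[R]_n) : 0 < t -> convex_set Y -> Y 0 ->
    forall i j, (i <= j)%N -> dilate (i%:R * t) Y `<=` dilate (j%:R * t) Y.
  move=> t0 cY Y0 i j ij; apply: dilate_le => //.
  by rewrite mulr_ge0 ?(ltW t0) //= ler_wpM2r ?(ltW t0) // ler_nat.
have M0 : signed_join lambda X 0.
  by apply: dM => i; rewrite mxE normr0 ltW.
have bound N J t (Y : set 'rV[R]_n) : Y `<=` @cube R n r -> 0 < t -> t <= s ->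
    J%:R * s * r <= N%:R ->
    forall j, (j <= J)%N -> dilate (j%:R * t) Y `<=` @cube R n N%:R.
  move=> Yr t0 ts JN j jJ; apply: dilate_sub_cube Yr _.
    by rewrite mulr_ge0 // ltW.
  apply: le_trans JN; apply: ler_wpM2r => //.
  by apply: ler_pM; rewrite ?(ltW t0) // ler_nat.
have ses : s * e <= s.
  by rewrite ler_piMr ?(ltW s0) // eE mulr_ile1 ?(ltW l0) ?(ltW l1) ?(ltW m0) // gerBl ltW.
have sls : s * lambda <= s by rewrite ler_piMr // ltW.
have sms : s * (1 - lambda) <= s by rewrite ler_piMr ?gerBl // ltW.
pose c := (s * (s * e)) ^+ n; have c0 : 0 < c by rewrite exprn_gt0 // mulr_gt0.
(* Of the 6 levels, 2 are lost in the lower bounds, 2 in the integer shift and 2 in the upper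
   bounds. *)
apply: (@conv_pow_growth R _ _ n 6 n0); first by rewrite mulr_ge0.
move=> m; rewrite -(ler_pM2l c0).
(* [N] is large enough for all dilates up to level [m + 4]. *)
pose N := (Num.truncn ((m.+2 + 2)%:R * s * r)).+1.
have NP : (m.+2 + 2)%:R * s * r <= N%:R by exact: ltW (truncnS_gt _).
have MX i z : dilate (i%:R * s) (signed_join lambda X) z ->
    exists q : 'rV[R]_n, (forall c, q 0 c \is a Num.int) /\
    forall m u, (i <= m)%N -> dilate ((m - i)%:R * (s * e)) X u ->
      exists2 j, (j <= m + 2)%N &
        dilate (j%:R * (s * (1 - lambda))) X (z + (u + q)) /\
        dilate ((m + 2 - j)%:R * (s * lambda)) X (u + q).
  by rewrite -sE; apply: (signed_join_shift l01 s0 d0) => //; rewrite sE sed ler1n.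
have main := @sum_lat_conv_le R n N m.+2 2 _ _ _ _
  (mono _ _ sm0 cX X0) (mono _ _ sl0 cX X0) (mono _ _ s0 cM M0) (mono _ _ se0 cX X0)
  (bound _ _ _ _ Xr sm0 sms NP) (bound _ _ _ _ Xr sl0 sls NP) MX.
rewrite -(ler_nat R) !natr_sum in main.
apply: le_trans (_ : \sum_(i < m.+3) (w * (i.-1%:R * s) ^+ n) *
    (V * ((m.+2 - i).-1%:R * (s * e)) ^+ n) <= _).
  rewrite (eq_bigr (fun i : 'I_m.+3 => c * (w * V) *
      (i.-1 ^ n * (m.+2 - i).-1 ^ n)%:R)) => [|i _].
    rewrite -mulr_sumr mulrA ler_wpM2l ?mulr_ge0 ?(ltW c0) //.
    by have := conv_pow_shift_ge n m; rewrite -(ler_nat R) [leRHS]natr_sum.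
  by rewrite natrM !natrX /c !exprMn; ring.
have le4 i : (i <= m.+2)%N -> (i <= m.+2 + 2)%N by move=> ?; rewrite (leq_trans _ (leq_addr _ _)).
apply: le_trans (le_trans _ main) _.
  apply: ler_sum => i _; rewrite natrM.
  have im : (i <= m.+2)%N by rewrite -ltnS.
  apply: ler_pM; rewrite ?mulr_ge0 ?exprn_ge0 ?mulr_ge0 ?(ltW s0) ?(ltW e0) //.
    apply: (Vol_le_lat_level n0 cM d'0 dM) => //; first by apply: lt_le_trans sdm; rewrite ltr1n.
    by apply: (bound _ _ _ _ Mr s0 (lexx s) NP); exact: le4.
  apply: (Vol_le_lat_level n0 cX d0 dX) => //; first by rewrite sed ltr1n.
  by apply: (bound _ _ _ _ Xr se0 ses NP); apply: le4; exact: leq_subr.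
apply: le_trans (_ : \sum_(i < (m.+2 + 2).+1) ((i.+1%:R * (s * (1 - lambda))) ^+ n * v) *
    (((m.+2 + 2 - i).+1%:R * (s * lambda)) ^+ n * v) <= _).
  apply: ler_sum => i _; rewrite natrM; apply: ler_pM => //.
    apply: (lat_level_le _ cX X0 sm0 d0) => [|t]; last exact: XP.
    by rewrite -mulrA; apply: le_trans sdm; rewrite ler1n.
  by apply: (lat_level_le _ cX X0 sl0 d0) => [|t]; [apply: le_trans sdl; rewrite ler1n | exact: XP].
rewrite (eq_bigr (fun i : 'I_(m.+2 + 2).+1 => c * (v * v) *
    (i.+1 ^ n * (m.+2 + 2 - i).+1 ^ n)%:R)) => [|i _].
  rewrite -mulr_sumr [leRHS]mulrA ler_wpM2l ?mulr_ge0 ?(ltW c0) //.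
  have -> : (m + 6 = (m.+2 + 2).+2)%N by rewrite !addnS !addn0.
  by have := conv_pow_shift_le n (m.+2 + 2); rewrite -(ler_nat R) [leLHS]natr_sum.
by rewrite natrM !natrX /c eE !exprMn; ring.
Qed.

Theorem theorem1p5 (R : realType) (n : nat) (K : set 'rV[R]_n) (lambda : R) :
  convex_body K -> K 0 -> 0 <= lambda <= 1 ->
  (Vol (cvx_join (dilate (1 - lambda) K) (dilate (- lambda) K)) <= Vol K)%E.
Proof.
move=> [cptK cK intK] K0 l01.
apply: le_trans (le_Vol (cvx_join_sub_signed_join cK K0)) _.
(* In dimension 0 the only point is the origin. *)
have [n0|n_gt0] := posnP n.
  by apply: le_Vol => x _; have -> : x = 0 by apply/rowP => -[i i0]; exfalso; rewrite n0 in i0.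
have /andP[l0 l1] := l01.
(* At [lambda = 0] the join lies in [K], at [lambda = 1] in [- K]; in between,
   [lambda * (1 - lambda) > 0], as the counting argument requires. *)
have [l_eq0|l_neq0] := eqVneq lambda 0.
  apply: le_Vol => _ [t [a [b [/andP[t0 t1] Ka [y _ <-] ->]]]].
  rewrite l_eq0 mulr0 scale0r !subr0 in Ka *.
  have : dilate 1 K a.
    by apply: (dilate_le cK K0 _ Ka); rewrite mulr1 subr_ge0 t1 gerBl t0.
  by case=> z Kz <-; rewrite scale1r.
have [l_eq1|l_neq1] := eqVneq lambda 1.
  apply: le_trans (Vol_dilateN1 K).
  apply: le_Vol => _ [t [_ [b [/andP[t0 t1] [y _ <-] Kb ->]]]].
  rewrite l_eq1 subrr mulr0 scale0r sub0r mulr1 in Kb *.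
  have [z Kz <-] : dilate 1 K b by apply: (dilate_le cK K0 _ Kb); rewrite t0.
  by exists z => //; rewrite scaleN1r scale1r.
have l01' : 0 < lambda < 1 by rewrite !lt_neqAle eq_sym l_neq0 l_neq1 l0 l1.
rewrite leNgt; apply/negP => KM.
have Kfin : Vol K \is a fin_num.
  by rewrite ge0_fin_numE ?Vol_ge0 // (lt_le_trans KM) // leey.
have V0 : 0 < fine (Vol K) by rewrite -lte_fin fineK // Vol_gt0.
set V := fine (Vol K) in V0; have VE : Vol K = V%:E by rewrite fineK.
(* [w] is a real number even if the volume of the join is infinite. *)
have [w Vw wM] : exists2 w, V < w & (w%:E <= Vol (signed_join lambda K))%E.
  move: KM; rewrite VE; case: (Vol (signed_join lambda K)) => [w| |] //.
    by rewrite lte_fin => Vw; exists w.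
  by move=> _; exists (V + 1); rewrite ?ltrDl // leey.
(* With [v = sqrt x], [v ^ 2] is [V] times the midpoint of [V] and [w]; so [V < v] while
   [v ^ 2 < w * V], against the product bound. *)
pose x := V * ((V + w) / 2); have x0 : 0 < x by rewrite !mulr_gt0 ?invr_gt0 // addr_gt0 // (lt_trans V0).
have Vx : V < Num.sqrt x.
  rewrite -[V in V < _]ger0_norm ?(ltW V0) // -sqrtr_sqr ltr_sqrt // expr2 ltr_pM2l //.
  by rewrite ltr_pdivlMr // mulr_natr mulr2n ltrD2l.
have := @signed_join_volume_product R n lambda (Num.sqrt x) w V K n_gt0 cptK cK K0 l01'
  (ltW (lt_trans V0 Vw)) wM (ltW V0).
rewrite VE lexx lte_fin Vx => /(_ isT isT).
rewrite -expr2 sqr_sqrtr ?(ltW x0) // /x mulrC ler_pM2l //.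
by rewrite ler_pdivlMr // mulr_natr mulr2n lerD2r leNgt Vw.
Qed.
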